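(* Let $Y$ be a metric space and $\pi:\mathbb R^s\to Y$ a linear and quotient map. If $\varphi,\psi:Y\to\mathbb R^s$ are intrinsically Lipschitz sections of $\pi$, then their sum $\varphi+\psi$ is an intrinsically Lipschitz section (of the map $\tfrac12\pi$), i.e. $\tfrac12\pi\circ(\varphi+\psi)=\mathrm{id}_Y$ and there is $L\in[1,\infty)$ such that, with $\eta=\varphi+\psi$, $$d(\eta(y_1),\eta(y_2))\le L\,d\big(\eta(y_1),(\tfrac12\pi)^{-1}(y_2)\big),\qquad\forall y_1,y_2\in Y.$$
   Context: $Y$ carries a real vector space structure for which $\pi$ is linear. $d$ is the distance on $\mathbb R^s$ and $d(x,A)=\inf_{a\in A}d(x,a)$. A quotient map is continuous, open and surjective. A section of $\pi$ is a map $\varphi:Y\to\mathbb R^s$ with $\pi\circ\varphi=\mathrm{id}_Y$; it is intrinsically Lipschitz if there is $L\in[1,\infty)$ with $d(\varphi(y_1),\varphi(y_2))\le L\,d(\varphi(y_1),\pi^{-1}(y_2))$ for all $y_1,y_2\in Y$. The map $\tfrac12\pi$ is $x\mapsto\tfrac12\pi(x)$. *)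

(* Defs.v *)
From HB Require Import structures.
From mathcomp Require Import all_boot all_order all_algebra.
From mathcomp Require Import all_classical all_reals topology.

Set Implicit Arguments.
Unset Strict Implicit.
Unset Printing Implicit Defensive.

Import Order.TTheory GRing.Theory Num.Theory.
Import numFieldTopology.Exports.

Local Open Scope classical_set_scope.
Local Open Scope ring_scope.

(* No compatibility between the metric and the linear structure is required. *)
#[short(type="metricLmodType")]
HB.structure Definition MetricLmodule (R : numDomainType) :=
  {Y of Metric R Y & GRing.Lmodule R Y}.

(* The library norm on row vectors is the sup norm, so the Euclidean distance
   is defined by hand; both induce the product topology carried by 'rV[R]_s. *)
Definition euclid_dist (R : realType) (s : nat) (x y : 'rV[R]_s) : R :=
  Num.sqrt (\sum_(i < s) (x ord0 i - y ord0 i) ^+ 2).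

(* As inf set0 = 0, this is only meaningful for A nonempty; it is used below on
   fibres of surjective maps. *)
Definition euclid_dist_set (R : realType) (s : nat)
    (x : 'rV[R]_s) (A : set 'rV[R]_s) : R :=
  inf [set euclid_dist x a | a in A].

Definition quotient_map (X Y : topologicalType) (f : X -> Y) : Prop :=
  [/\ continuous f,
      forall U : set X, open U -> open (f @` U)
    & set_surj [set: X] [set: Y] f].

Definition intrinsically_lipschitz_section (R : realType) (s : nat) (Y : Type)
    (pi : 'rV[R]_s -> Y) (phi : Y -> 'rV[R]_s) : Prop :=
  (forall y : Y, pi (phi y) = y) /\
  exists2 L : R, 1 <= L & forall y1 y2 : Y,
    euclid_dist (phi y1) (phi y2)
      <= L * euclid_dist_set (phi y1) (pi @^-1` [set y2]).

(* Main.v *)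
(* Each affine bijection [a |-> phi y1 + (a - eta y1) / 2] sends the fibre of
   [2^-1 *: pi] over [y2] into the fibre of [pi] over [y2] and halves the
   distance to the base point, so a displacement [D] from [eta y1] to its fibre
   bounds [d(phi y1, phi y2)] by [L1 * (D / 2)] and [d(psi y1, psi y2)] by
   [L2 * (D / 2)]; hence [eta] has constant [max L1 L2]. *)
Require Import Defs.
From mathcomp Require Import all_boot all_order all_algebra.
From mathcomp Require Import all_classical all_reals topology.
From mathcomp Require Import ring lra.

Import Order.TTheory GRing.Theory Num.Theory.
Import numFieldTopology.Exports.

Local Open Scope classical_set_scope.
Local Open Scope ring_scope.

Lemma euclid_dist_ge0 (R : realType) (s : nat) (x y : 'rV[R]_s) :
  0 <= euclid_dist x y.
Proof. exact: sqrtr_ge0. Qed.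

Lemma euclid_dist_translate (R : realType) (s : nat) (k : R)
    (x a b : 'rV[R]_s) :
  euclid_dist x (x + k *: (b - a)) = `|k| * euclid_dist a b.
Proof.
rewrite /euclid_dist -(sqrtr_sqr k) -sqrtrM ?sqr_ge0// mulr_sumr.
by congr Num.sqrt; apply: eq_bigr => i _; rewrite !mxE; ring.
Qed.

(** The shared bound [c] keeps the termwise estimate on squares lossless: it ends at
    [2 * (c ^+ 2 + c ^+ 2)], which is exactly [(2 * c) ^+ 2]. *)
Lemma euclid_distD_le (R : realType) (s : nat) (c : R)
    (x1 x2 y1 y2 : 'rV[R]_s) :
  euclid_dist x1 x2 <= c -> euclid_dist y1 y2 <= c ->
  euclid_dist (x1 + y1) (x2 + y2) <= 2 * c.
Proof.
move=> xc yc; have c0 : 0 <= c := le_trans (euclid_dist_ge0 _ _ _ _) xc.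
have sqr_le u v : euclid_dist u v <= c ->
    \sum_(i < s) (u ord0 i - v ord0 i) ^+ 2 <= c ^+ 2.
  move=> uvc; rewrite -[leLHS]sqr_sqrtr; last first.
    by apply: sumr_ge0 => i _; exact: sqr_ge0.
  by rewrite ler_sqr ?nnegrE ?sqrtr_ge0.
have c20 : 0 <= 2 * c by lra.
rewrite -[leRHS]ger0_norm// -sqrtr_sqr ler_wsqrtr//.
(* [(p + q)^2 <= 2 (p^2 + q^2)] termwise *)
apply: (@le_trans _ _ (2 * (\sum_(i < s) (x1 ord0 i - x2 ord0 i) ^+ 2 +
    \sum_(i < s) (y1 ord0 i - y2 ord0 i) ^+ 2))).
  rewrite -big_split mulr_sumr; apply: ler_sum => i _ /=; rewrite !mxE.
  have := sqr_ge0 ((x1 ord0 i - x2 ord0 i) - (y1 ord0 i - y2 ord0 i)).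
  by nra.
by have := sqr_le _ _ xc; have := sqr_le _ _ yc; nra.
Qed.

Lemma euclid_dist_set_le (R : realType) (s : nat) (x a : 'rV[R]_s)
    (A : set 'rV[R]_s) :
  A a -> euclid_dist_set x A <= euclid_dist x a.
Proof.
move=> Aa; apply: ge_inf; last by exists a.
by exists 0 => _ [b _ <-]; exact: euclid_dist_ge0.
Qed.

Lemma le_euclid_dist_set (R : realType) (s : nat) (c : R) (x : 'rV[R]_s)
    (A : set 'rV[R]_s) :
  A !=set0 -> (forall a, A a -> c <= euclid_dist x a) ->
  c <= euclid_dist_set x A.
Proof.
move=> [a Aa] cA; apply: lb_le_inf; first by exists (euclid_dist x a); exists a.
by move=> _ [b Ab <-]; exact: cA.
Qed.

(** Serves both sections at once: [e] will be [phi y1 + psi y1], and [M] a common bound for their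
    two constants. *)
Lemma section_dist_le_half (R : realType) (s : nat) (Y : lmodType R)
    (pi : {linear 'rV[R]_s -> Y}) (phi : Y -> 'rV[R]_s) (L M : R)
    (y1 y2 : Y) (e a : 'rV[R]_s) :
  pi (phi y1) = y1 -> 0 <= L -> L <= M ->
  euclid_dist (phi y1) (phi y2)
    <= L * euclid_dist_set (phi y1) (pi @^-1` [set y2]) ->
  2^-1 *: pi e = y1 -> 2^-1 *: pi a = y2 ->
  euclid_dist (phi y1) (phi y2) <= M * (2^-1 * euclid_dist e a).
Proof.
move=> phiK L0 LM /le_trans + ey ay; apply.
apply: (le_trans (ler_wpM2l L0 _)); last first.
  by apply: (ler_wpM2r _ LM); rewrite mulr_ge0 ?euclid_dist_ge0 ?invr_ge0.
have <- : `|2^-1 : R| = 2^-1 by rewrite ger0_norm// invr_ge0.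
(* The competitor in the infimum is [phi y1 + 2^-1 *: (a - e)]; its image under [pi] is
   [y1 + (y2 - y1)]. *)
rewrite -(euclid_dist_translate _ _ _ (phi y1)); apply: euclid_dist_set_le => /=.
by rewrite linearD linearZ linearB /= phiK scalerBr ey ay addrC subrK.
Qed.

Theorem theorem4p1 (R : realType) (s : nat) (Y : metricLmodType R)
    (pi : {linear 'rV[R]_s -> Y}) (phi psi : Y -> 'rV[R]_s)
    (pi_quotient : quotient_map pi)
    (phi_lip : intrinsically_lipschitz_section pi phi)
    (psi_lip : intrinsically_lipschitz_section pi psi) :
  intrinsically_lipschitz_section
    (fun x : 'rV[R]_s => 2^-1 *: pi x) (fun y : Y => phi y + psi y).
Proof.
case: phi_lip => phiK [L1 L1_ge1 phiL]; case: psi_lip => psiK [L2 L2_ge1 psiL].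
have etaK y : 2^-1 *: pi (phi y + psi y) = y.
  by rewrite linearD /= phiK psiK -mulr2n -scaler_nat scalerA mulVf ?scale1r ?pnatr_eq0.
split=> //; set M := Num.max L1 L2.
have M_ge1 : 1 <= M by rewrite le_max L1_ge1.
have M_gt0 : 0 < M := lt_le_trans ltr01 M_ge1.
(* Dividing by [M] isolates the infimum, so that it suffices to bound the distance to each point of
   the fibre. *)
exists M => // y1 y2; rewrite -ler_pdivrMl//.
(* The fibre over [y2] is nonempty: by [etaK] it contains the value of the sum at [y2]. *)
apply: le_euclid_dist_set => [|a /= ay]; first by exists (phi y2 + psi y2) => /=.
rewrite ler_pdivrMl//.
(* Exposes the form [2 * c] for the sum estimate, each summand getting half of the displacement. *)
have -> : M * euclid_dist (phi y1 + psi y1) a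
    = 2 * (M * (2^-1 * euclid_dist (phi y1 + psi y1) a)) by field.
apply: euclid_distD_le.
- apply: (section_dist_le_half _ _ _ _ _ _ _ _ _ _ _ (phiK y1) _ _ (phiL y1 y2)) => //.
    exact: le_trans ler01 L1_ge1.
  by rewrite le_max lexx.
- apply: (section_dist_le_half _ _ _ _ _ _ _ _ _ _ _ (psiK y1) _ _ (psiL y1 y2)) => //.
    exact: le_trans ler01 L2_ge1.
  by rewrite le_max lexx orbT.
Qed.
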